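(* Let $L$ be a separable nonmetrizable scattered compact space of height 3. Then there is no uncountable strongly irredundant family of clopen subsets of $L$. Therefore $L$ is not a Boolean image of a connected compact space.
   Context: All compact spaces are Hausdorff and nonempty; ''zero-dimensional'' means having a base of clopen sets. A scattered compact space $L$ has height 3 if its third Cantor–Bendixson derivative is empty while its second one, $L''$, is nonempty. (Scattered compact spaces are zero-dimensional.) For a family $\mathcal{F}$ of clopen subsets of $L$, $\langle\mathcal{F}\rangle$ denotes the generated subalgebra of the algebra of clopen subsets of $L$ (so $\langle\emptyset\rangle=\{\emptyset,L\}$). A family $\mathcal{G}$ of clopen subsets of $L$ is strongly irredundant if for all disjoint $\mathcal{F},\mathcal{F}'\subset\mathcal{G}$ the algebra $\langle\mathcal{F}\rangle\cap\langle\mathcal{F}'\rangle$ is trivial, i.e. equal to $\{\emptyset,L\}$. A pseudoclopen of a compact space $K$ is a pair $a=(a^-,a^+)$ with $a^-\subset K$ closed, $a^+\subset K$ open and $a^-\subset a^+$. Let $\mathcal{G}$ be a family of subsets of a nonempty set $X$. A bijection $\phi$ from $\mathcal{G}$ onto a family of pseudoclopens of $K$ is an isomorphism if for all $n,m\ge 0$ and all distinct $a_1,\ldots,a_n,b_1,\ldots,b_m\in\mathcal{G}$: (1) if $\bigcap_{i\le n}a_i\setminus\bigcup_{j\le m}b_j=\emptyset$ then $\bigcap_{i\le n}\phi(a_i)^+\setminus\bigcup_{j\le m}\phi(b_j)^-=\emptyset$; (2) if $\bigcap_{i\le n}\phi(a_i)^-\setminus\bigcup_{j\le m}\phi(b_j)^+=\emptyset$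 then $\bigcap_{i\le n}a_i\setminus\bigcup_{j\le m}b_j=\emptyset$. (Empty intersections are $X$, respectively $K$.) A zero-dimensional compact space $L$ is a Boolean image of a compact space $K$ if there is a family $\mathcal{G}$ of clopen subsets of $L$ (regarded as subsets of $X=L$) which separates the points of $L$ (for all $x\neq y$ in $L$ there is $a\in\mathcal{G}$ with $|a\cap\{x,y\}|=1$) and which is isomorphic to a family of pseudoclopens of $K$. *)

(* Defs.v *)
From HB Require Import structures.
From mathcomp Require Import all_boot all_order all_algebra.
From mathcomp Require Import all_classical all_reals all_analysis.

Set Implicit Arguments.
Unset Strict Implicit.
Unset Printing Implicit Defensive.

Local Open Scope classical_set_scope.

Section topological_notions.
Context (T : topologicalType).
Implicit Types A : set T.

Definition separable := exists2 D : set T, countable D & dense D.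

Definition metrizable (R : realType) :=
  exists (M : metricType R) (f : T -> M) (g : M -> T),
    [/\ cancel f g, cancel g f, continuous f & continuous g].

Definition cb_derivative A := A `\` isolated A.

Definition scattered := forall A, A !=set0 -> isolated A !=set0.

Definition height3 :=
  iter 3 cb_derivative [set: T] = set0 /\
  iter 2 cb_derivative [set: T] !=set0.

End topological_notions.

Section clopen_algebras.
Context (X : Type).
Implicit Types F G M : set (set X).

Definition set_algebra M := [/\ M set0, setU_closed M & setC_closed M].

(* The clopen subsets of a space form a set algebra, so for a family of clopen
   sets this is also the subalgebra of the clopen algebra that it generates. *)
Definition generated_algebra F : set (set X) := smallest set_algebra F.

Definition strongly_irredundant G :=
  forall F F', F `<=` G -> F' `<=` G -> F `&` F' = set0 ->
    generated_algebra F `&` generated_algebra F' = [set set0; [set: X]].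

(* |a `&` {x, y}| = 1 is rendered by saying that this set is a singleton. *)
Definition separates_points G :=
  forall x y : X, x <> y ->
    exists2 a, G a & exists z, a `&` [set x; y] = [set z].

End clopen_algebras.

(* A pair [p] stands for (a^-, a^+), with a^- = p.1 and a^+ = p.2. *)
Definition pseudoclopen (K : topologicalType) (p : set K * set K) :=
  [/\ closed p.1, open p.2 & p.1 `<=` p.2].

(* [phi] is only constrained on [G]; intersections over 'I_0 are the full set. *)
Definition pseudoclopen_iso (X : Type) (K : topologicalType)
    (G : set (set X)) (H : set (set K * set K))
    (phi : set X -> set K * set K) :=
  [/\ H `<=` @pseudoclopen K, set_bij G H phi &
    forall (n m : nat) (a : 'I_n -> set X) (b : 'I_m -> set X),
      (forall i, G (a i)) -> (forall j, G (b j)) ->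
      injective a -> injective b -> (forall i j, a i <> b j) ->
      (\bigcap_i a i `\` \bigcup_j b j = set0 ->
       \bigcap_i (phi (a i)).2 `\` \bigcup_j (phi (b j)).1 = set0) /\
      (\bigcap_i (phi (a i)).1 `\` \bigcup_j (phi (b j)).2 = set0 ->
       \bigcap_i a i `\` \bigcup_j b j = set0)].

(* Meant for nonempty compact Hausdorff [L] and [K]. That [L] is
   zero-dimensional is not repeated here: a compact space with a
   point-separating family of clopen sets has a base of clopen sets. *)
Definition boolean_image (L K : topologicalType) :=
  exists G : set (set L),
    [/\ G `<=` clopen, separates_points G &
      exists (H : set (set K * set K)) (phi : set L -> set K * set K),
        pseudoclopen_iso G H phi].

(* Main.v *)
(** Write D for the countable set of isolated points of L, and L', L'' for the
    derivatives; L'' is finite, and a clopen set missing L'' has finite trace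
    on L'. Given an uncountable strongly irredundant family G, two members with
    the same trace on L'' have a symmetric difference missing L'' and containing
    a point of D. Hence, for some d in D and some n, outside of every countable
    part of G there are finitely many members generating a clopen set x that
    contains d, misses L'' and has a trace on L' of size at most n. For the
    least such n, closure under intersection forces, outside of some countable
    U0, all these x to have the same trace on L'. They then differ by finite
    subsets of D, so there are only countably many of them, and one of them is
    generated by two disjoint subfamilies of G: a contradiction.

    If K is connected and G is isomorphic to a family of pseudoclopens of K, then
    G is strongly irredundant. Indeed, let c be generated both by F and by a
    disjoint F'. Call t in K and x in L compatible if t in a^- implies x in a,
    which implies t in a^+, for the finitely many relevant a. Points of L with
    prescribed membership in the a with t in a^+ \ a^- exist by condition (1), so
    two points compatible with the same t can be interpolated by one agreeing
    with the first on F and with the second on F'; thus c or its complement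
    contains both. This makes the points t compatible with some point of c a
    clopen subset of K. Finally a countable separating family of clopen sets
    would make L metrizable. *)
Require Import Defs.
From HB Require Import structures.
From mathcomp Require Import all_boot all_order all_algebra.
From mathcomp Require Import finmap.
From mathcomp Require Import all_classical all_reals all_analysis.

Set Implicit Arguments.
Unset Strict Implicit.
Unset Printing Implicit Defensive.

Local Open Scope classical_set_scope.

(** * Countability and generated set algebras *)

Lemma countable_inj_into (T U : Type) (A : set T) (B : set U) (f : T -> U) :
  {in A &, injective f} -> (forall x, A x -> B (f x)) -> countable B ->
  countable A.
Proof.
move=> finj fAB; apply: sub_countable.
rewrite -(card_le_eql (inj_card_eq finj)); apply: subset_card_le.
by move=> _ [x Ax <-]; exact: fAB.
Qed.

Lemma countableU (T : Type) (A B : set T) :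
  countable A -> countable B -> countable (A `|` B).
Proof.
by move=> Ac Bc; rewrite -bigcup2E; apply: bigcup_countable => // -[|[|i]] _.
Qed.

Section generated_algebra_theory.
Context (X : Type).
Implicit Types F G : set (set X).

Lemma set_algebra_generated F : set_algebra (generated_algebra F).
Proof.
split.
- by move=> M [[]].
- move=> A B FA FB M /= MF; have [[_ MU _] _] := MF.
  by apply: MU; [exact: FA|exact: FB].
- move=> A FA M /= MF; have [[_ _ MC] _] := MF.
  by apply: MC; exact: FA.
Qed.

Lemma generated_algebra_incl F a : F a -> generated_algebra F a.
Proof. exact: sub_gen_smallest. Qed.

Lemma generated_algebra0 F : generated_algebra F set0.
Proof. by have [] := set_algebra_generated F. Qed.

Lemma generated_algebraC F a :
  generated_algebra F a -> generated_algebra F (~` a).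
Proof. by have [_ _ FC] := set_algebra_generated F => Fa; exact: (FC a Fa). Qed.

Lemma generated_algebraU F a b : generated_algebra F a ->
  generated_algebra F b -> generated_algebra F (a `|` b).
Proof.
by have [_ FU _] := set_algebra_generated F => Fa Fb; exact: (FU a b Fa Fb).
Qed.

Lemma generated_algebraT F : generated_algebra F setT.
Proof.
by rewrite -setC0; apply: generated_algebraC; exact: generated_algebra0.
Qed.

Lemma generated_algebraI F a b : generated_algebra F a ->
  generated_algebra F b -> generated_algebra F (a `&` b).
Proof.
move=> Fa Fb; rewrite -[_ `&` _]setCK setCI; apply: generated_algebraC.
by apply: generated_algebraU; exact: generated_algebraC.
Qed.

Lemma generated_algebraY F a b : generated_algebra F a ->
  generated_algebra F b -> generated_algebra F (a `+` b).
Proof.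
move=> Fa Fb; apply: generated_algebraU; rewrite setDE;
  apply: generated_algebraI => //; exact: generated_algebraC.
Qed.

Lemma generated_algebra_sub F F' : F `<=` F' ->
  generated_algebra F `<=` generated_algebra F'.
Proof. by apply: sub_smallest2r; exact: set_algebra_generated. Qed.

Lemma generated_algebra_finite F a : generated_algebra F a ->
  exists A, [/\ finite_set A, A `<=` F & generated_algebra A a].
Proof.
move: a; apply: smallest_sub; first split.
- by exists set0; split=> //; exact: generated_algebra0.
- move=> a b [A [Afin AF Aa]] [B [Bfin BF Bb]].
  exists (A `|` B); split; first by rewrite finite_setU.
    by rewrite subUset.
  apply: generated_algebraU; first exact: generated_algebra_sub Aa.
  exact: generated_algebra_sub Bb.
- by move=> a [A [? ? ?]]; exists A; split=> //; exact: generated_algebraC.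
- move=> a Fa; exists [set a]; split=> //; first by move=> _ ->.
  exact: generated_algebra_incl.
Qed.

(** The sets that do not tell [x] from [y] form a set algebra. *)
Lemma generated_algebra_indiscernible F a (x y : X) :
  (forall b, F b -> b x <-> b y) -> generated_algebra F a -> a x <-> a y.
Proof.
move=> Fxy; move: a; apply: smallest_sub => //; split => //.
  by move=> a b /= ax bx; rewrite ax bx.
by move=> a /= ax; rewrite /setC/= ax.
Qed.

Lemma strongly_irredundant_trivial G F F' a :
  strongly_irredundant G -> F `<=` G -> F' `<=` G -> F `&` F' = set0 ->
  generated_algebra F a -> generated_algebra F' a -> a = set0 \/ a = setT.
Proof.
move=> GI FG F'G FF' Fa F'a.
by have : [set set0; [set: X]] a by rewrite -(GI _ _ FG F'G FF').
Qed.

End generated_algebra_theory.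

(** * Clopen sets and Cantor-Bendixson derivatives *)

Section clopen_generated.
Context (T : topologicalType).

Lemma clopen_generated_algebra (F : set (set T)) :
  F `<=` clopen -> generated_algebra F `<=` clopen.
Proof.
apply: smallest_sub; split; [exact: clopen0|exact: clopenU|].
by move=> A; exact: clopenC.
Qed.

Lemma closed_cb_derivative (A : set T) : closed A -> closed (cb_derivative A).
Proof.
move=> Acl x clx; split.
  by apply: Acl => B /clx[y [[Ay _] By]]; exists y.
move=> [_ [V Vx VA]]; have [y [[Ay Ny] Vy]] := clx V Vx.
have : (V `&` A) y by [].
rewrite VA => yx; apply: Ny; split; first exact: mem_set.
by rewrite yx; exists V.
Qed.

(** If [B] were infinite, the filter of sets containing all but finitely many points of [B] would
    cluster at a point of [B]. Such a point cannot be isolated in [A]. *)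
Lemma finite_disjoint_cb_derivative (A B : set T) : compact [set: T] ->
  closed B -> B `<=` A -> B `&` cb_derivative A = set0 -> finite_set B.
Proof.
move=> Tco Bcl BA BA'; apply: contrapT => Binf.
pose F : set_system T := [set P | finite_set (B `\` P)].
have FF : ProperFilter F.
  split; first by rewrite /F/= setD0.
  split; first by rewrite /F/= setDT.
    by move=> P Q FP FQ; rewrite /F/= setDIr finite_setU.
  by move=> P Q PQ; apply: sub_finite_set => x [Bx Qx]; split=> // /PQ.
have [|p [Bp clp]] := subclosed_compact Bcl Tco (@subsetT _ B) FF.
  by rewrite /F/= setDv.
have [_ [V Vp VA]] : isolated A p.
  apply: contrapT => Np; suff : set0 p by [].
  by rewrite -BA'; split=> //; split=> //; exact: BA.
have FBp : F (B `\ p).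
  by apply: (sub_finite_set _ (finite_set1 p)) => x [Bx]; apply: contra_notP.
have [y [[By +] Vy]] := clp (B `\ p) V FBp Vp.
by apply; rewrite -[[set p]]VA; split=> //; exact: BA.
Qed.

(** A dense set contains every isolated point of the space. *)
Lemma countable_isolatedT : separable T -> countable (isolated [set: T]).
Proof.
move=> [D Dc Dd]; apply: sub_countable Dc; apply: subset_card_le => x [_ [V]].
rewrite setIT nbhsE => -[U [Uo Ux] UV] Vx.
have [|y [Uy Dy]] := Dd U _ Uo; first by exists x.
by have := UV y Uy; rewrite Vx => <-.
Qed.

Lemma open_meets_isolated (U : set T) : scattered T -> open U -> U !=set0 ->
  exists2 d, isolated [set: T] d & U d.
Proof.
move=> Tsc Uo /Tsc[d [/set_mem Ud [V Vd VU]]]; exists d => //.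
split; first exact/mem_set.
exists (V `&` U); last by rewrite setIT.
by apply: filterI => //; exact: open_nbhs_nbhs.
Qed.

End clopen_generated.

(** * Countability of strongly irredundant families *)

Section no_uncountable_strongly_irredundant.
Context (L : topologicalType).
Hypothesis L_compact : compact [set: L].
Hypothesis L_scattered : scattered L.
Hypothesis L_separable : separable L.

Local Notation L0 := [set: L].
Local Notation L1 := (cb_derivative L0).
Local Notation L2 := (cb_derivative L1).

Hypothesis L2_neq0 : L2 !=set0.
Hypothesis L3_eq0 : cb_derivative L2 = set0.

Let closedL1 : closed L1.
Proof. by apply: closed_cb_derivative; exact: closedT. Qed.

Let closedL2 : closed L2.
Proof. exact: closed_cb_derivative. Qed.

Lemma finite_second_derivative : finite_set L2.
Proof.
apply: (@finite_disjoint_cb_derivative _ L2) => //.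
by rewrite L3_eq0 setI0.
Qed.

Lemma finite_trace_first_derivative (x : set L) :
  clopen x -> x `&` L2 = set0 -> finite_set (x `&` L1).
Proof.
move=> [_ xcl] xL2; apply: (@finite_disjoint_cb_derivative _ L1) => //.
- exact: closedI.
- by rewrite setIAC xL2 set0I.
Qed.

Lemma finite_isolated_clopen (x : set L) : clopen x -> x `&` L1 = set0 ->
  finite_set x /\ x `<=` isolated L0.
Proof.
move=> [_ xcl] xL1; split.
  exact: (@finite_disjoint_cb_derivative _ L0).
move=> d xd; apply: contrapT => Nd; suff : set0 d by [].
by rewrite -xL1; split=> //; split.
Qed.

Context (G : set (set L)).
Hypothesis G_clopen : G `<=` clopen.
Hypothesis G_irredundant : strongly_irredundant G.

(* [U] is meant as the family of members of [G] that are already used up. *)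
Let piece (U : set (set L)) (d : L) (F : set (set L)) (x : set L) :=
  [/\ finite_set F, F `<=` G `\` U, generated_algebra F x, x d &
      x `&` L2 = set0].

Let trace_size (x : set L) := #|` fset_set (x `&` L1)|.

Let unavoidable d n := forall U, countable U ->
  exists F x, piece U d F x /\ (trace_size x <= n)%N.

Let piece_clopen U d F x : piece U d F x -> clopen x.
Proof.
move=> [_ FG Fx _ _]; apply: clopen_generated_algebra Fx => a /FG[Ga _].
exact: G_clopen.
Qed.

Let finite_trace U d F x : piece U d F x -> finite_set (x `&` L1).
Proof.
move=> px; apply: finite_trace_first_derivative; first exact: piece_clopen px.
by have [] := px.
Qed.

Let pieceI U d F F' x x' : piece U d F x -> piece U d F' x' ->
  piece U d (F `|` F') (x `&` x').
Proof.
move=> [Ffin FG Fx xd xL2] [F'fin F'G F'x' x'd x'L2]; split=> //.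
- by rewrite finite_setU.
- by rewrite subUset.
- by apply: generated_algebraI;
    [apply: generated_algebra_sub Fx|apply: generated_algebra_sub F'x'].
- by rewrite setIAC xL2 set0I.
Qed.

Let piece_sub U U' d F x : U `<=` U' -> piece U' d F x -> piece U d F x.
Proof.
by move=> UU' [? FG ? ? ?]; split=> // a /FG[Ga U'a]; split=> // /UU'.
Qed.

Let exists_unavoidable : ~ countable G ->
  exists d n, unavoidable d n.
Proof.
move=> Gunc; apply: contrapT => Nun.
(* Were no pair unavoidable, each [(d, n)] would have a countable [V (d, n)] outside of which all
   pieces at [d] have trace size above [n]. *)
have /choice[V VP] : forall dn : L * nat, exists U, countable U /\
    forall F x, piece U dn.1 F x -> (trace_size x > dn.2)%N.
  move=> [d n]; apply: contrapT => NU; apply: Nun; exists d, n => U Uc.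
  apply: contrapT => NF; apply: NU; exists U; split=> // F x Fx.
  by rewrite ltnNge; apply/negP => xn; apply: NF; exists F, x.
pose U := \bigcup_(dn in isolated L0 `*` [set: nat]) V dn.
have Uc : countable U.
  apply: bigcup_countable => [|dn _]; last by have [] := VP dn.
  apply: countableX => //; exact: countable_isolatedT.
(* [L2] has only countably many finite subsets, so taking traces on it is not injective on the
   uncountable rest of [G]. *)
have [a [b [Ga Gb Ua Ub [abL2 ab]]]] : exists a b : set L,
    [/\ G a, G b, ~ U a, ~ U b & a `&` L2 = b `&` L2 /\ a <> b].
  apply: contrapT => Nab; apply: Gunc.
  rewrite -(setUIDK G U); apply: countableU.
    by apply: sub_countable Uc; apply: subset_card_le.
  pose B := [set A | A `<=` L2 /\ finite_set A].
  apply: (@countable_inj_into _ _ _ B (fun a => a `&` L2)).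
  - move=> a b /set_mem[Ga Ua] /set_mem[Gb Ub] abL2.
    by apply: contrapT => ab; apply: Nab; exists a, b.
  - move=> a _; split=> //.
    by apply: sub_finite_set finite_second_derivative.
  - apply: countable_finite_subset; apply: finite_set_countable.
    exact: finite_second_derivative.
have Fab : generated_algebra [set a; b] (a `+` b).
  by apply: generated_algebraY; apply: generated_algebra_incl; [left|right].
have abG : [set a; b] `<=` G by move=> _ [] ->.
have [abo _] : clopen (a `+` b).
  by apply: clopen_generated_algebra Fab => c /abG /G_clopen.
have ab0 : a `+` b !=set0.
  apply/set0P/eqP => ab0; apply: ab.
  by rewrite -(set0Y b) -ab0 -setYA setYK setY0.
have [d dD abd] := open_meets_isolated L_scattered abo ab0.
(* With [n] chosen as the trace size of this very piece, avoiding [V (d, n)] makes that size larger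
   than itself. *)
have [_ /(_ [set a; b] (a `+` b))] := VP (d, trace_size (a `+` b)).
rewrite /= ltnn => pab; apply/notF/pab; split=> //.
- move=> c [] ->; split=> // Vc; [apply: Ua|apply: Ub];
  by exists (d, trace_size (a `+` b)).
- by rewrite setIYl abL2 setYK.
Qed.

Lemma countable_of_strongly_irredundant : countable G.
Proof.
apply: contrapT => /exists_unavoidable[d [m mun]].
have : exists n, `[< unavoidable d n >] by exists m; exact/asboolP.
move=> /ex_minnP[n /asboolP nun nmin].
(* For [n = 0] the bound is vacuous; otherwise minimality of [n] says that some countable set
   defeats [n - 1]. *)
have [U0 [U0c U0n]] : exists U0, countable U0 /\
    forall F x, piece U0 d F x -> (n <= trace_size x)%N.
  case: n nun nmin => [|n] _ nmin; first by exists set0.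
  apply: contrapT => NU0; suff : (n < n)%N by rewrite ltnn.
  apply: nmin; apply/asboolP => U Uc; apply: contrapT => NF.
  apply: NU0; exists U; split=> // F x Fx.
  by rewrite ltnNge; apply/negP => xn; apply: NF; exists F, x.
(* The intersection is again a piece, so its trace has at least [n] points and cannot be a proper
   part of that of [x]. *)
have trace_eq F F' x x' : piece U0 d F x -> piece U0 d F' x' ->
    (trace_size x <= n)%N -> x `&` L1 `<=` x' `&` L1.
  move=> px px' xn; have pI := pieceI px px'.
  suff <- : (x `&` x') `&` L1 = x `&` L1 by move=> y [[]].
  apply: fset_set_inj; [exact: finite_trace pI|exact: finite_trace px|].
  apply/eqP; rewrite eqEfcard; apply/andP; split.
    rewrite -fset_set_sub; [by move=> y [[]]|exact: finite_trace pI|].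
    exact: finite_trace px.
  exact: leq_trans xn (U0n _ _ pI).
pose X := [set x | exists F, piece U0 d F x /\ (trace_size x <= n)%N].
have Xc : countable X.
  have [F1 [x1 [p1 x1n]]] := nun U0 U0c.
  pose B := [set A | A `<=` isolated L0 /\ finite_set A].
  (* Adding a fixed [x1] is injective, and equal traces on [L1] cancel, leaving finite sets of
     isolated points. *)
  apply: (@countable_inj_into _ _ _ B (fun x => x `+` x1)).
  - move=> x y _ _ xy.
    by rewrite -(setY0 x) -(setYK x1) setYA xy -setYA setYK setY0.
  - move=> x [F [px xn]]; have : clopen (x `+` x1).
      have [_ FG Fx _ _] := pieceI px p1.
      have [_ _ gx _ _] := px; have [_ _ gx1 _ _] := p1.
      apply: (@clopen_generated_algebra _ (F `|` F1)).
        by move=> c /FG[/G_clopen].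
      by apply: generated_algebraY;
        [apply: generated_algebra_sub gx|apply: generated_algebra_sub gx1].
    move=> /finite_isolated_clopen[|? ?]; last by split.
    have -> : (x `+` x1) `&` L1 = (x `&` L1) `+` (x1 `&` L1).
      by rewrite setIYl.
    suff -> : x `&` L1 = x1 `&` L1 by rewrite setYK.
    by apply/seteqP; split;
      [exact: trace_eq px p1 xn|exact: trace_eq p1 px x1n].
  - by apply: countable_finite_subset; exact: countable_isolatedT.
(* Fix one generating family for each member of [X]. Together they are countable, so they can be
   discarded as well; the next small piece is again in [X], now with a disjoint generating
   family. *)
have /choice[FX FXP] : forall x, exists F, X x -> piece U0 d F x.
  move=> x; have [[F [px _]]|NXx] := pselect (X x); first by exists F.
  by exists set0.
have [|F [x [px xn]]] := nun (U0 `|` \bigcup_(x in X) FX x).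
  apply: countableU => //; apply: bigcup_countable => // x /FXP[Ffin _ _ _ _].
  exact: finite_set_countable.
have Xx : X x by exists F; split=> //; apply: piece_sub px; exact: subsetUl.
have [_ FG Fx xd xL2] := px; have [_ FXG FXx _ _] := FXP x Xx.
have FF0 : F `&` FX x = set0.
  by apply/seteqP; split=> // a [/FG[_ Na] FXa]; apply: Na; right; exists x.
have [] := strongly_irredundant_trivial G_irredundant _ _ FF0 Fx FXx.
- by move=> a /FG[].
- by move=> a /FXG[].
- by move=> x0; rewrite x0 in xd.
- by move=> xT; move: xL2 L2_neq0; rewrite xT setTI => -> [].
Qed.

End no_uncountable_strongly_irredundant.

(** * Families of pseudoclopens of a connected space *)

Lemma finite_set_ord_enum (T : eqType) (S : set T) : finite_set S ->
  exists n (f : 'I_n -> T), injective f /\ range f = S.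
Proof.
move=> /finite_seqP[s ->]; exists (size (undup s)), (tnth (in_tuple (undup s))).
split; first by apply/tuple_uniqP; exact: undup_uniq.
apply/seteqP; split=> [_ [i _ <-]|a /= sa].
  by rewrite /= -mem_undup; exact: (mem_tnth i (in_tuple (undup s))).
have /tnthP[i ->] : a \in in_tuple (undup s) by rewrite /= mem_undup.
by exists i.
Qed.

Section pseudoclopen_families.
Context (X : Type) (K : topologicalType).
Context (G : set (set X)) (H : set (set K * set K)).
Context (phi : set X -> set K * set K).
Hypothesis phi_iso : pseudoclopen_iso G H phi.

Lemma pseudoclopen_isoP (a : set X) : G a -> pseudoclopen (phi a).
Proof.
by have [HK [phiG _ _] _] := phi_iso => Ga; exact/HK/phiG.
Qed.

(** Contrapositives of conditions (1) and (2), read at a point, with finite sets in place of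
    injective families. *)
Lemma pseudoclopen_iso_cell (S T : set (set X)) :
  finite_set S -> finite_set T -> S `<=` G -> T `<=` G -> S `&` T = set0 ->
  (forall t, (forall a, S a -> (phi a).2 t) ->
     (forall a, T a -> ~ (phi a).1 t) ->
     exists x, (forall a, S a -> a x) /\ (forall a, T a -> ~ a x)) /\
  (forall x, (forall a, S a -> a x) -> (forall a, T a -> ~ a x) ->
     exists t, (forall a, S a -> (phi a).1 t) /\
               (forall a, T a -> ~ (phi a).2 t)).
Proof.
move=> /finite_set_ord_enum[n [f [finj <-]]].
move=> /finite_set_ord_enum[m [g [ginj <-]]] fG gG fg.
have [_ _ /(_ n m f g)] := phi_iso.
case=> //; [by move=> i; exact: fG|by move=> j; exact: gG| |].
  move=> i j fgij; suff : set0 (f i) by [].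
  by rewrite -fg; split; [exists i|exists j].
move=> iso1 iso2; split.
  move=> t tS tT; apply: contrapT => Nx; suff : set0 t by [].
  rewrite -iso1; first split.
  - by move=> i _; apply: tS; exists i.
  - by move=> [j _]; apply: tT; exists j.
  - apply/seteqP; split=> // x [xf xg]; apply: Nx; exists x; split.
      by move=> _ [i _ <-]; exact: xf.
    by move=> _ [j _ <-] xj; apply: xg; exists j.
move=> x xS xT; apply: contrapT => Nt; suff : set0 x by [].
rewrite -iso2; first split.
- by move=> i _; apply: xS; exists i.
- by move=> [j _]; apply: xT; exists j.
- apply/seteqP; split=> // t [tf tg]; apply: Nt; exists t; split.
    by move=> _ [i _ <-]; exact: tf.
  by move=> _ [j _ <-] tj; apply: tg; exists j.
Qed.

Section compatibility.
Context (E : set (set X)).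
Hypothesis E_finite : finite_set E.
Hypothesis E_sub : E `<=` G.

Let compatible (t : K) (x : X) :=
  forall a, E a -> ((phi a).1 t -> a x) /\ (a x -> (phi a).2 t).

(* Condition (1): on the fuzzy part [(phi a).2 `\` (phi a).1] membership in [a]
   can be prescribed at will. *)
Lemma prescribed_point (S : set (set X)) (t : K) :
  (forall a, E a -> ((phi a).1 t -> S a) /\ (S a -> (phi a).2 t)) ->
  exists x, forall a, E a -> a x <-> S a.
Proof.
move=> St; have [||||| /(_ t) cell _] :=
    @pseudoclopen_iso_cell (E `&` S) (E `\` S).
- exact: finite_setIl.
- exact: finite_setD.
- by move=> a [/E_sub].
- by move=> a [/E_sub].
- by apply/seteqP; split=> // a [[_ aS] [_ aT]]; exact: aT.
have [||x [xS xT]] := cell.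
- by move=> a [Ea Sa]; apply (St a Ea).
- by move=> a [Ea NSa] at1; apply: NSa; apply (St a Ea).
exists x => a Ea; split => [ax|Sa]; last exact: xS.
by apply: contrapT => NSa; apply: xT ax.
Qed.

Lemma compatible_point (t : K) : exists x, compatible t x.
Proof.
(* The least admissible prescription: only the [a] with [t] in a^-. *)
have [|x xt] := @prescribed_point (fun a => (phi a).1 t) t.
  move=> a /E_sub /pseudoclopen_isoP[_ _ a12]; split=> //.
  exact: a12.
by exists x => a Ea; have [_ _ a12] := pseudoclopen_isoP (E_sub Ea);
  split=> [/(xt a Ea)//|/(xt a Ea)/a12].
Qed.

Lemma compatible_pseudopoint (x : X) : exists t, compatible t x.
Proof.
have [|||||_ /(_ x) cell] :=
    @pseudoclopen_iso_cell (E `&` [set a | a x]) (E `\` [set a | a x]).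
- exact: finite_setIl.
- exact: finite_setD.
- by move=> a [/E_sub].
- by move=> a [/E_sub].
- by apply/seteqP; split=> // a [[_ aS] [_ aT]]; exact: aT.
have [||t [tS tT]] := cell; [by move=> a []|by move=> a []|].
exists t => a Ea; have [_ _ a12] := pseudoclopen_isoP (E_sub Ea).
split=> [at1|ax]; last by apply: a12; exact: tS.
by apply: contrapT => ax; apply: (tT a) => //; exact: a12.
Qed.

Let shadow (c : set X) := [set t | exists2 x, c x & compatible t x].

Lemma compatible_invariant (F F' : set (set X)) (c : set X) t x y :
  F `<=` E -> F' `<=` E -> F `&` F' = set0 ->
  generated_algebra F c -> generated_algebra F' c ->
  compatible t x -> compatible t y -> c x -> c y.
Proof.
move=> FE F'E FF' Fc F'c tx ty cx.
(* [z] follows [x] on [F] and [y] elsewhere, in particular on [F']. *)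
have [|z zS] := @prescribed_point
    [set a | (F a -> a x) /\ (~ F a -> a y)] t.
  move=> a Ea; have [tx1 tx2] := tx a Ea; have [ty1 ty2] := ty a Ea.
  split=> [at1|[xa ya]]; first by split=> _; [exact: tx1|exact: ty1].
  by have [Fa|Fa] := pselect (F a); [exact/tx2/xa|exact/ty2/ya].
have xz a : F a -> a x <-> a z.
  move=> Fa; rewrite zS; last exact: FE.
  by split=> [ax|[] /(_ Fa)//]; split.
have zy a : F' a -> a z <-> a y.
  move=> F'a; have Fa : ~ F a by move=> Fa; suff : set0 a by []; rewrite -FF'.
  by rewrite zS; [split=> [[_ /(_ Fa)]//|ay]; split|exact: F'E].
apply/(generated_algebra_indiscernible zy F'c).
exact/(generated_algebra_indiscernible xz Fc).
Qed.

Lemma open_shadow (F F' : set (set X)) (c : set X) :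
  F `<=` E -> F' `<=` E -> F `&` F' = set0 ->
  generated_algebra F c -> generated_algebra F' c -> open (shadow c).
Proof.
move=> FE F'E FF' Fc F'c; rewrite openE => t [x cx tx].
(* For [s] in [W], the membership of [x] in the sets of [F] is still an admissible prescription. As
   [F] is finite, [W] is a neighbourhood of [t]. *)
pose W := \bigcap_(a in F) [set s | if `[< a x >] then (phi a).2 s
                                    else ~ (phi a).1 s].
have Wt : nbhs t W.
  have Ffin : finite_set F by exact: sub_finite_set E_finite.
  rewrite /W -(fset_setK Ffin); apply: filter_bigI => a.
  rewrite in_fset_set// inE => Fa; have Ea := FE a Fa.
  have [a1 a2 a12] := pseudoclopen_isoP (E_sub Ea); have [tx1 tx2] := tx a Ea.
  case: asboolP => ax; apply: open_nbhs_nbhs; split => //=; last 2 first.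
  - exact: closed_openC.
  - by move=> /tx1.
  - exact: tx2.
apply: filterS Wt => s Ws.
(* Agreement with [x] on [F] puts [z] in [c]; elsewhere the least prescription makes [z] compatible
   with [s]. *)
have [|z zS] := @prescribed_point
    [set a | (F a -> a x) /\ (~ F a -> (phi a).1 s)] s.
  move=> a Ea; have [_ _ a12] := pseudoclopen_isoP (E_sub Ea).
  have [Fa|Fa] := pselect (F a); last first.
    by split=> [as1|[_ /(_ Fa)/a12]//]; split=> // /Fa.
  have := Ws a Fa; rewrite /=; case: asboolP => ax sa.
    by split=> // _; split.
  by split=> [/sa//|[/(_ Fa)]//].
have xz a : F a -> a x <-> a z.
  move=> Fa; rewrite zS; last exact: FE.
  by split=> [ax|[] /(_ Fa)//]; split.
exists z; first exact/(generated_algebra_indiscernible xz Fc).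
move=> a Ea; have [_ _ a12] := pseudoclopen_isoP (E_sub Ea).
rewrite zS//=; have [Fa|Fa] := pselect (F a); last first.
  by split=> [as1|[_ /(_ Fa)/a12]//]; split=> // /Fa.
have := Ws a Fa; rewrite /=; case: asboolP => ax sa.
  by split=> // _; split.
by split=> [/sa//|[/(_ Fa)]//].
Qed.

Lemma common_generated_algebra_trivial (F F' : set (set X)) (c : set X) :
  connected [set: K] ->
  F `<=` E -> F' `<=` E -> F `&` F' = set0 ->
  generated_algebra F c -> generated_algebra F' c -> c = set0 \/ c = setT.
Proof.
move=> Kco FE F'E FF' Fc F'c.
have inv t x y := @compatible_invariant F F' c t x y FE F'E FF' Fc F'c.
have [->|/set0P[x cx]] := eqVneq c set0; first by left.
(* The two shadows are disjoint by [inv] and cover [K] by [compatible_point]. *)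
right; have shadowC : shadow c = ~` shadow (~` c).
  apply/seteqP; split=> [t [y cy ty] [z cz tz]|t Nt].
    by apply: cz; exact: inv ty tz cy.
  have [y ty] := compatible_point t.
  by exists y => //; apply: contrapT => cy; apply: Nt; exists y.
have shadowT : shadow c = setT.
  apply: Kco; first by have [t tx] := compatible_pseudopoint x; exists t, x.
    by exists (shadow c); rewrite ?setTI//; exact: (open_shadow FE F'E).
  exists (shadow c); rewrite ?setTI// shadowC; apply: open_closedC.
  by apply: (open_shadow FE F'E) => //; exact: generated_algebraC.
apply/seteqP; split=> // y _; have [t ty] := compatible_pseudopoint y.
have [z cz tz] : shadow c t by rewrite shadowT.
exact: inv tz ty cz.
Qed.

End compatibility.

Lemma strongly_irredundant_of_connected :
  connected [set: K] -> strongly_irredundant G.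
Proof.
move=> Kco F F' FG F'G FF'; apply/seteqP; split=> c; last first.
  by move=> [] ->; split;
    solve [exact: generated_algebra0|exact: generated_algebraT].
move=> [/generated_algebra_finite[A [Afin AF Ac]]].
move=> /generated_algebra_finite[A' [A'fin A'F A'c]].
(* Only finitely many generators of [c] matter on either side. *)
apply: (@common_generated_algebra_trivial (A `|` A') _ _ A A') => //.
- by rewrite finite_setU.
- by move=> a [/AF/FG|/A'F/F'G].
- by apply/seteqP; split=> // a [/AF Fa /A'F F'a]; rewrite -FF'.
Qed.

End pseudoclopen_families.

(** * Metrizability from a countable separating family *)

Section separating_sequence_metric.
Import Order.TTheory GRing.Theory Num.Theory.
Local Open Scope ring_scope.
Context (R : realType) (T : choiceType) (b : nat -> set T).

Let separated_at (x y : T) : pred nat := fun n => `[< ~ (b n x <-> b n y) >].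

(** The successor keeps the distance finite and positive when index 0 already separates. *)
Definition sepdist (x y : T) : R :=
  if pselect (exists n, separated_at x y n) is left xy
  then (ex_minn xy).+1%:R^-1 else 0.

Lemma sepdist_leP (x y : T) (r : R) : 0 <= r ->
  (sepdist x y <= r) <-> (forall n, ~ (b n x <-> b n y) -> n.+1%:R^-1 <= r).
Proof.
move=> r0; rewrite /sepdist; case: pselect => [xy|Nxy]; last first.
  split=> // _ n bn; exfalso; apply: Nxy; exists n; exact/asboolP.
case: ex_minnP => m /asboolP bm mmin; split=> [mr n bn|]; last exact.
apply: le_trans mr; rewrite lef_pV2 ?posrE ?ltr0n// ler_nat ltnS.
exact/mmin/asboolP.
Qed.

Lemma sepdist_ge0 (x y : T) : 0 <= sepdist x y.
Proof. by rewrite /sepdist; case: pselect. Qed.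

Lemma sepdist_ge (x y : T) n : ~ (b n x <-> b n y) -> n.+1%:R^-1 <= sepdist x y.
Proof. by move: n; apply/sepdist_leP => //; exact: sepdist_ge0. Qed.

Lemma sepdistxx (x : T) : sepdist x x = 0.
Proof.
by apply/eqP; rewrite eq_le sepdist_ge0 andbT; apply/sepdist_leP => // n [].
Qed.

Lemma sepdist_sym (x y : T) : sepdist x y = sepdist y x.
Proof.
suff le z t : sepdist z t <= sepdist t z by apply/eqP; rewrite eq_le !le.
apply/sepdist_leP => [|n bn]; first exact: sepdist_ge0.
by apply: sepdist_ge => tz; apply: bn; split=> /tz.
Qed.

(** An index separating [x] from [z] separates [y] from one of them. *)
Lemma sepdist_triangle (y x z : T) : sepdist x z <= sepdist x y + sepdist y z.
Proof.
apply/sepdist_leP => [|n bxz]; first by rewrite addr_ge0 ?sepdist_ge0.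
have [bxy|/sepdist_ge bxy] := pselect (b n x <-> b n y); last first.
  by rewrite (le_trans bxy)// lerDl sepdist_ge0.
have /sepdist_ge byz : ~ (b n y <-> b n z) by rewrite -bxy.
by rewrite (le_trans byz)// lerDr sepdist_ge0.
Qed.

Hypothesis b_separates : forall x y, x <> y -> exists n, ~ (b n x <-> b n y).

Lemma sepdist_positivity (x y : T) : sepdist x y = 0 -> x = y.
Proof.
move=> xy0; apply: contrapT => /b_separates[n /sepdist_ge].
by rewrite xy0 leNgt invr_gt0 ltr0n.
Qed.

End separating_sequence_metric.

(* The dummy parameter [R] lets the metric structure be inferred. *)
Definition sepspace (R : realType) (T : choiceType) (b : nat -> set T)
  (b_separates : forall x y, x <> y -> exists n, ~ (b n x <-> b n y)) : Type :=
  T.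

Section sepspace_metric.
Context (R : realType) (T : choiceType) (b : nat -> set T).
Hypothesis b_separates : forall x y, x <> y -> exists n, ~ (b n x <-> b n y).

HB.instance Definition _ := Choice.on (sepspace R b_separates).
HB.instance Definition _ := @isMetric.Build R (sepspace R b_separates)
  (sepdist R b) (sepdistxx R b) (sepdist_positivity b_separates)
  (sepdist_sym R b) (sepdist_triangle R b).

End sepspace_metric.

Section metrizability.
Import Order.TTheory GRing.Theory Num.Theory.
Local Open Scope ring_scope.

(** The identity is a continuous bijection from a compact space onto a Hausdorff one. *)
Lemma metrizable_of_separating_sequence (R : realType) (T : topologicalType)
    (b : nat -> set T) : compact [set: T] -> (forall n, clopen (b n)) ->
  (forall x y, x <> y -> exists n, ~ (b n x <-> b n y)) -> metrizable T R.
Proof.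
move=> Tco bclopen b_separates.
pose M : metricType R := sepspace R b_separates.
pose f : T -> M := idfun; pose g : M -> T := idfun.
have fcont : continuous f.
  move=> x; apply/metricType_numDomainType.cvgrPdist_lt => e e0.
  (* Beyond index [m] the terms are at most [e / 2]; halving [e] turns the weak bound of
     [sepdist_leP] into a strict one. *)
  pose m := Num.bound (e / 2)^-1.
  pose N := \bigcap_(n in `I_m) [set y | b n x <-> b n y].
  have Nx : nbhs x N.
    rewrite /N -(fset_setK (finite_II _)); apply: filter_bigI => n _.
    have [bo bc] := bclopen n.
    have [bx|bx] := pselect (b n x).
      by apply: filterS (open_nbhs_nbhs (conj bo bx)) => y.
    by apply: filterS (open_nbhs_nbhs (conj (closed_openC bc) bx)) => y by_.
  have e20 : 0 < e / 2 by rewrite divr_gt0.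
  apply: filterS Nx => y Ny.
  apply: (@le_lt_trans _ _ (e / 2) (sepdist R b x y)); last first.
    by rewrite ltr_pdivrMr// ltr_pMr// ltr1n.
  apply/sepdist_leP => [|n bn]; first exact: ltW.
  rewrite -[leRHS]invrK lef_pV2 ?posrE ?invr_gt0//.
  apply: (le_trans (ltW (archi_boundP _))); first by rewrite invr_ge0 ltW.
  by rewrite ler_nat leqW// leqNgt; apply/negP => nm; exact: bn (Ny n nm).
have gcont : continuous g.
  apply/continuous_closedP => A Acl.
  have -> : g @^-1` A = f @` A.
    by apply/seteqP; split=> [y Ay|_ [y Ay <-]] //; exists y.
  apply: compact_closed; first exact: metric_hausdorff.
  apply: continuous_compact; first exact: continuous_subspaceT.
  exact: subclosed_compact Acl Tco _.
by exists M, f, g; split.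
Qed.

End metrizability.

Lemma metrizable_of_countable_separating (R : realType) (T : topologicalType)
    (G : set (set T)) : compact [set: T] -> G `<=` clopen -> countable G ->
  separates_points G -> metrizable T R.
Proof.
move=> Tco Gclopen Gc Gsep.
have Gsep' x y : x <> y -> exists2 a, G a & ~ (a x <-> a y).
  move=> /[dup] xy /Gsep[a Ga [z az]]; exists a => // axy.
  have [az' []] : (a `&` [set x; y]) z by rewrite az.
    move=> zx; rewrite zx in az az'.
    have /= : [set x] y by rewrite -az; split; [exact/axy|right].
    exact/nesym.
  move=> zy; rewrite zy in az az'.
  by have /= : [set y] x by rewrite -az; split; [exact/axy|left].
(* An empty [G] has no enumeration, but then no two points are distinct and any clopen sequence will
   do. *)
have [G0|[b]] := pfcard_geP Gc.
  apply: (@metrizable_of_separating_sequence R T (fun=> set0)) => //.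
    by move=> _; exact: clopen0.
  by move=> x y /Gsep'[a]; rewrite G0.
apply: (@metrizable_of_separating_sequence R T b) => //.
  by move=> n; apply: Gclopen; exact: (@funS _ _ _ _ b n I).
move=> x y /Gsep'[a Ga axy]; have [n _ bn] := @surj _ _ _ _ b a Ga.
by exists n; rewrite bn.
Qed.

Theorem proposition3p12 (R : realType) (L : topologicalType)
    (L_neq0 : [set: L] !=set0)
    (L_compact : compact [set: L])
    (L_hausdorff : hausdorff_space L)
    (L_scattered : scattered L)
    (L_height3 : height3 L)
    (L_separable : separable L)
    (L_nonmetrizable : ~ metrizable L R) :
  (~ exists G : set (set L),
       [/\ G `<=` clopen, ~ countable G & strongly_irredundant G]) /\
  (forall K : topologicalType,
     [set: K] !=set0 -> compact [set: K] -> hausdorff_space K ->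
     connected [set: K] -> ~ boolean_image L K).
Proof.
have [L3_eq0 L2_neq0] := L_height3.
have noG (G : set (set L)) :
    G `<=` clopen -> strongly_irredundant G -> countable G.
  move=> Gclopen Girr.
  exact: (countable_of_strongly_irredundant L_compact L_scattered L_separable
            L2_neq0 L3_eq0 Gclopen Girr).
split=> [[G [Gclopen Gunc Girr]]|K _ _ _ Kco [G [Gclopen Gsep [H [phi iso]]]]].
  exact/Gunc/noG.
apply: L_nonmetrizable; apply: metrizable_of_countable_separating Gsep => //.
by apply: noG => //; exact: strongly_irredundant_of_connected iso Kco.
Qed.
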